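(* Let $a_1,a_2,a_3$ be pairwise distinct constants, $\phi(x)=4(a_1-x)(a_2-x)(a_3-x)$, and $\phi_k=\phi(u_k)$, $k=1,2$. On the space with coordinates $(u_1,u_2,p_{u_1},p_{u_2})$ consider $$H_1=\frac{\phi_1p_{u_1}^2}{u_1-u_2}+\frac{\phi_2p_{u_2}^2}{u_2-u_1},\qquad H_2=-\frac{u_2\phi_1p_{u_1}^2}{u_1-u_2}-\frac{u_1\phi_2p_{u_2}^2}{u_2-u_1},$$ and the Poisson bracket $\{\cdot,\cdot\}_W$ given by $$\{u_i,p_{u_j}\}_W=u_i\delta_{ij},\qquad \{u_1,u_2\}_W=\{p_{u_1},p_{u_2}\}_W=0.$$ Let $\tilde u_1,\tilde u_2$ be the roots of the polynomial $$\tilde U(x)=A_2x^2+A_1x+4a_1a_2a_3\left(\frac{\phi_1p_{u_1}^2}{u_1(u_2-u_1)}+\frac{\phi_2p_{u_2}^2}{u_2(u_1-u_2)}\right),$$ where $$A_2=\frac{\bigl(4u_1^2(u_2-u_1)-\phi_1\bigr)\phi_1p_{u_1}^2}{u_1^2(u_1-u_2)^2}+\frac{2\phi_1\phi_2p_{u_1}p_{u_2}}{u_1u_2(u_1-u_2)^2}+\frac{\bigl(4u_2^2(u_1-u_2)-\phi_2\bigr)\phi_2p_{u_2}^2}{u_2^2(u_2-u_1)^2},$$ $$A_1=\frac{\bigl(4u_1^2(a_1+a_2+a_3-u_1)-\phi_1\bigr)\phi_1p_{u_1}^2}{u_1^2(u_1-u_2)}+\frac{\bigl(4u_2^2(a_1+a_2+a_3-u_2)-\phi_2\bigr)\phi_2p_{u_2}^2}{u_2^2(u_2-u_1)},$$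 and let $$\tilde p_{u_k}=-\frac{x}{4(a_1-x)(a_2-x)(a_3-x)}\left.\left(\frac{(x-u_2)\phi_1p_{u_1}}{(u_1-u_2)u_1}+\frac{(x-u_1)\phi_2p_{u_2}}{(u_2-u_1)u_2}\right)\right|_{x=\tilde u_k},\qquad k=1,2.$$ Then the mapping $(u,p_u)\mapsto(\tilde u,\tilde p_u)$ preserves: (i) the form of the Hamiltonians: $H_k(\tilde u,\tilde p_u)=H_k(u,p_u)$, $k=1,2$; (ii) the Abel quadrature: along any curve on which $H_1$ and $H_2$ are constant, if $$\frac{\mathrm du_1}{\phi(u_1)p_{u_1}}+\frac{\mathrm du_2}{\phi(u_2)p_{u_2}}=2\,\mathrm d\tau ,\quad\text{then}\quad \frac{\mathrm d\tilde u_1}{\phi(\tilde u_1)\tilde p_{u_1}}+\frac{\mathrm d\tilde u_2}{\phi(\tilde u_2)\tilde p_{u_2}}=2\,\mathrm d\tau;$$ (iii) the form of the Poisson bracket $\{\cdot,\cdot\}_W$: $$\{\tilde u_i,\tilde p_{u_j}\}_W=\tilde u_i\delta_{ij},\qquad \{\tilde u_1,\tilde u_2\}_W=\{\tilde p_{u_1},\tilde p_{u_2}\}_W=0.$$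
   Context: The statement is local and generic: it is considered on an open set where all denominators are nonzero ($u_1\ne u_2$, $u_k\neq0$, $\phi_k p_{u_k}\ne0$, $A_2\neq0$, $\tilde u_1\ne\tilde u_2$, $\tilde u_k\ne 0$, $\phi(\tilde u_k)\tilde p_{u_k}\neq0$), with a smooth labelling of the two roots. On the level set of $H_1,H_2$ one has $(\phi_kp_{u_k})^2=f(u_k)$ with $f(x)=\phi(x)(H_1x+H_2)$, so that the quadrature in (ii) is $\mathrm du_1/\sqrt{f(u_1)}+\mathrm du_2/\sqrt{f(u_2)}=2\,\mathrm d\tau$ with the square roots $\sqrt{f(u_k)}=\phi_kp_{u_k}$. ($H_1,H_2$ are the integrals of free motion on the sphere in elliptic coordinates.) *)

(* Defs.v *)
From HB Require Import structures.
From mathcomp Require Import all_boot all_order all_algebra.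
From mathcomp Require Import all_classical all_reals all_analysis.

Set Implicit Arguments.
Unset Strict Implicit.
Unset Printing Implicit Defensive.

Import Order.TTheory GRing.Theory Num.Theory.
Import numFieldNormedType.Exports.
Local Open Scope classical_set_scope.
Local Open Scope ring_scope.

(* A point of the phase space is the row (u_1, u_2, p_{u_1}, p_{u_2}).  The
   index k = 1, 2 of the coordinates is represented by the ordinals 0, 1. *)
Notation phase R := 'rV[R]_(2 + 2).

Definition ucoord (R : realType) (k : 'I_2) (z : phase R) : R :=
  z 0 (lshift 2 k).

Definition pcoord (R : realType) (k : 'I_2) (z : phase R) : R :=
  z 0 (rshift 2 k).

Definition phi (R : realType) (a1 a2 a3 : R) (x : R) : R :=
  4 * (a1 - x) * (a2 - x) * (a3 - x).

Definition H1 (R : realType) (a1 a2 a3 : R) (z : phase R) : R :=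
  let u1 := ucoord 0 z in let u2 := ucoord 1 z in
  let p1 := pcoord 0 z in let p2 := pcoord 1 z in
  let phi1 := phi a1 a2 a3 u1 in let phi2 := phi a1 a2 a3 u2 in
  phi1 * p1 ^+ 2 / (u1 - u2) + phi2 * p2 ^+ 2 / (u2 - u1).

Definition H2 (R : realType) (a1 a2 a3 : R) (z : phase R) : R :=
  let u1 := ucoord 0 z in let u2 := ucoord 1 z in
  let p1 := pcoord 0 z in let p2 := pcoord 1 z in
  let phi1 := phi a1 a2 a3 u1 in let phi2 := phi a1 a2 a3 u2 in
  - (u2 * phi1 * p1 ^+ 2 / (u1 - u2)) - u1 * phi2 * p2 ^+ 2 / (u2 - u1).

Definition A2 (R : realType) (a1 a2 a3 : R) (z : phase R) : R :=
  let u1 := ucoord 0 z in let u2 := ucoord 1 z in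
  let p1 := pcoord 0 z in let p2 := pcoord 1 z in
  let phi1 := phi a1 a2 a3 u1 in let phi2 := phi a1 a2 a3 u2 in
    (4 * u1 ^+ 2 * (u2 - u1) - phi1) * phi1 * p1 ^+ 2
      / (u1 ^+ 2 * (u1 - u2) ^+ 2)
  + 2 * phi1 * phi2 * p1 * p2 / (u1 * u2 * (u1 - u2) ^+ 2)
  + (4 * u2 ^+ 2 * (u1 - u2) - phi2) * phi2 * p2 ^+ 2
      / (u2 ^+ 2 * (u2 - u1) ^+ 2).

Definition A1 (R : realType) (a1 a2 a3 : R) (z : phase R) : R :=
  let u1 := ucoord 0 z in let u2 := ucoord 1 z in
  let p1 := pcoord 0 z in let p2 := pcoord 1 z in
  let phi1 := phi a1 a2 a3 u1 in let phi2 := phi a1 a2 a3 u2 in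
    (4 * u1 ^+ 2 * (a1 + a2 + a3 - u1) - phi1) * phi1 * p1 ^+ 2
      / (u1 ^+ 2 * (u1 - u2))
  + (4 * u2 ^+ 2 * (a1 + a2 + a3 - u2) - phi2) * phi2 * p2 ^+ 2
      / (u2 ^+ 2 * (u2 - u1)).

Definition A0 (R : realType) (a1 a2 a3 : R) (z : phase R) : R :=
  let u1 := ucoord 0 z in let u2 := ucoord 1 z in
  let p1 := pcoord 0 z in let p2 := pcoord 1 z in
  let phi1 := phi a1 a2 a3 u1 in let phi2 := phi a1 a2 a3 u2 in
  4 * a1 * a2 * a3 *
    (phi1 * p1 ^+ 2 / (u1 * (u2 - u1)) + phi2 * p2 ^+ 2 / (u2 * (u1 - u2))).

Definition Utilde (R : realType) (a1 a2 a3 : R) (z : phase R) : {poly R} :=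
  A2 a1 a2 a3 z *: 'X^2 + A1 a1 a2 a3 z *: 'X + (A0 a1 a2 a3 z)%:P.

Definition ptilde (R : realType) (a1 a2 a3 : R) (z : phase R) (x : R) : R :=
  let u1 := ucoord 0 z in let u2 := ucoord 1 z in
  let p1 := pcoord 0 z in let p2 := pcoord 1 z in
  let phi1 := phi a1 a2 a3 u1 in let phi2 := phi a1 a2 a3 u2 in
  - (x / phi a1 a2 a3 x) *
    ((x - u2) * phi1 * p1 / ((u1 - u2) * u1)
     + (x - u1) * phi2 * p2 / ((u2 - u1) * u2)).

(* ut is the chosen labelling of the roots of Utilde. *)
Definition tilde_map (R : realType) (a1 a2 a3 : R) (ut : 'I_2 -> phase R -> R)
    (z : phase R) : phase R :=
  row_mx (\row_k ut k z) (\row_k ptilde a1 a2 a3 z (ut k z)).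

Definition partial (R : realType) (n : nat) (i : 'I_n) (f : 'rV[R]_n -> R) :
    'rV[R]_n -> R :=
  fun z => 'D_(delta_mx 0 i) f z.

(* C^oo on U (meant for open U): all iterated partial derivatives, including f
   itself (s = [::]), are differentiable at every point of U. *)
Definition smooth_on (R : realType) (n : nat) (U : set 'rV[R]_n)
    (f : 'rV[R]_n -> R) : Prop :=
  forall (s : seq 'I_n) (z : 'rV[R]_n), U z ->
    differentiable (foldr (@partial R n) f s) z.

(* Brackets of the coordinate functions: {u_i, p_j} = u_i delta_ij,
   {u_i, u_j} = {p_i, p_j} = 0. *)
Definition Wmx (R : realType) (z : phase R) : 'M[R]_(2 + 2) :=
  let D := diag_mx (\row_k ucoord k z) in block_mx 0 D (- D) 0.

Definition bracketW (R : realType) (F G : phase R -> R) (z : phase R) : R :=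
  \sum_i \sum_j Wmx z i j * partial i F z * partial j G z.

(* du_1/(phi(u_1) p_1) + du_2/(phi(u_2) p_2) = 2 dtau along gamma, on J. *)
Definition Abel_quadrature (R : realType) (a1 a2 a3 : R) (J : set R)
    (gamma : R -> phase R) (tau : R -> R) : Prop :=
  forall t, J t ->
    \sum_(k < 2) derive1 (ucoord k \o gamma) t
      / (phi a1 a2 a3 (ucoord k (gamma t)) * pcoord k (gamma t))
    = 2 * derive1 tau t.

(* Main.v *)
(* Put L(x) = V1 x + V0, the line through the points (u_k, phi_k p_k / u_k).
   The quartic phi(x) (H1 x + H2) - (x L(x))^2 vanishes at u_1 and u_2, and
   Utilde is its quotient by (x - u_1)(x - u_2); so at the roots ut_k of Utilde
   the values phi ptilde = - x L(x) satisfy (phi ptilde)^2 = phi (H1 x + H2),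
   which is (i).

   For (iii), the brackets of the coefficients of L and Utilde close up:
   {Utilde(x), Utilde(y)} and {Utilde(x), L(y)} are given by polynomial
   identities that determine {ut_i, ut_j} and {ut_i, L(ut_j)} by implicit
   differentiation.  They have no denominator u_k - ut_j, so coincidences
   between old and new points need no separate treatment.

   (ii) follows from (i) and (iii).  Bracketing ut_i with the relation
   phi(ut_k) ptilde_k^2 = H1 ut_k + H2 gives {ut_i, H_m}, and shows that
   sum_k d ut_k / (phi ptilde_k) equals 2 on the Hamiltonian field of H1 and 0
   on that of H2, exactly as for (u, p).  The two fields span the common kernel
   of dH1 and dH2, which contains the velocity of the curve. *)

Require Import Defs.
From HB Require Import structures.
From mathcomp Require Import all_boot all_order all_algebra.
From mathcomp Require Import all_classical all_reals all_analysis.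
From mathcomp Require Import ring.

Set Implicit Arguments.
Unset Strict Implicit.
Unset Printing Implicit Defensive.

Import Order.TTheory GRing.Theory Num.Theory.
Import numFieldNormedType.Exports.
Local Open Scope classical_set_scope.
Local Open Scope ring_scope.

(** * Gradients *)

(** Carrying the gradient as an explicit row lets the differentiation rules compute it, so that
    every bracket becomes algebra on rows. *)
Definition has_grad (R : realType) (n : nat) (F : 'rV[R]_n -> R)
    (z g : 'rV[R]_n) : Prop :=
  is_diff z F (fun v => (v *m g^T) 0 0).

Section Gradient.
Context {R : realType} {n : nat}.
Implicit Types (F G : 'rV[R]_n -> R) (z g h v : 'rV[R]_n).

Lemma has_grad_eq F z g h : has_grad F z g -> g = h -> has_grad F z h.
Proof. by move=> + <-. Qed.

Lemma has_grad_cst (c : R) z : has_grad (fun=> c) z 0.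
Proof.
apply: (is_diff_eq (is_diff_cst c z)).
by apply/funext => v; rewrite trmx0 mulmx0 mxE.
Qed.

Lemma has_grad_coord i z : has_grad (fun z => z 0 i) z (delta_mx 0 i).
Proof.
have lin : linear (fun v : 'rV[R]_n => v 0 i) by move=> a u v; rewrite !mxE.
pose l : {linear 'rV[R]_n -> R} :=
  HB.pack (fun v : 'rV[R]_n => v 0 i) (GRing.isLinear.Build _ _ _ _ _ lin).
apply: DiffDef; first exact: differentiable_coord.
rewrite -[X in 'd X z]/(l : _ -> _) diff_lin; last exact: coord_continuous.
by apply/funext => v; rewrite trmx_delta -colE mxE.
Qed.

Lemma has_gradD F G z g h : has_grad F z g -> has_grad G z h ->
  has_grad (fun x => F x + G x) z (g + h).
Proof.
move=> Fg Gh; apply: (is_diff_eq (is_diffD Fg Gh)).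
by apply/funext => v; rewrite linearD mulmxDr mxE.
Qed.

Lemma has_gradN F z g : has_grad F z g -> has_grad (fun x => - F x) z (- g).
Proof.
move=> Fg; apply: (is_diff_eq (is_diffN Fg)).
by apply/funext => v; rewrite linearN mulmxN mxE.
Qed.

Lemma has_gradM F G z g h : has_grad F z g -> has_grad G z h ->
  has_grad (fun x => F x * G x) z (F z *: h + G z *: g).
Proof.
move=> Fg Gh; apply: (is_diff_eq (is_diffM Fg Gh)).
by apply/funext => v; rewrite !fctE linearD !linearZ mulmxDr -!scalemxAr !mxE.
Qed.

Lemma has_grad_sqr F z g : has_grad F z g ->
  has_grad (fun x => F x ^+ 2) z ((2 * F z) *: g).
Proof.
move=> Fg; apply: (has_grad_eq (has_gradM Fg Fg)).
by rewrite -scalerDl mulr_natl mulr2n.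
Qed.

Lemma has_gradV F z g : F z != 0 -> has_grad F z g ->
  has_grad (fun x => (F x)^-1) z (- (F z) ^- 2 *: g).
Proof.
move=> F0 [Fd FE]; apply: DiffDef; first exact: differentiableV.
by rewrite diffV// FE; apply/funext => v; rewrite linearZ -scalemxAr mxE.
Qed.

Lemma has_grad_derive F z g v : has_grad F z g -> 'D_v F z = (v *m g^T) 0 0.
Proof. by move=> [Fd FE]; rewrite deriveE// FE. Qed.

Lemma has_grad_partial F z g i : has_grad F z g -> partial i F z = g 0 i.
Proof.
by rewrite /partial => /has_grad_derive ->; rewrite -rowE !mxE.
Qed.

Lemma differentiable_has_grad F z :
  differentiable F z -> has_grad F z (\row_i partial i F z).
Proof.
move=> Fd; apply: DiffDef => //; apply/funext => v.
rewrite {1}(row_sum_delta v) linear_sum mxE; apply: eq_bigr => i _.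
by rewrite linearZ !mxE -deriveE.
Qed.

(** This is the tool for implicit differentiation: an equation valid near [z] becomes a linear
    relation between gradients. *)
Lemma has_grad_near0 F z g :
  (\forall x \near z, F x = 0) -> has_grad F z g -> g = 0.
Proof.
move=> F0 /has_grad_partial Fg; apply/rowP => i; rewrite -Fg mxE /partial.
by rewrite (near_eq_derive _ F0 (g := cst 0)) derive_cst.
Qed.

Lemma has_grad_curve F (gamma : R -> 'rV[R]_n) t g :
  has_grad F (gamma t) g -> derivable gamma t 1 ->
  'D_1 (F \o gamma) t = ('D_1 gamma t *m g^T) 0 0.
Proof.
move=> [Fd FE] /derivable1_diffP gd.
rewrite (deriveE _ (differentiable_comp gd Fd)) (deriveE _ gd).
by rewrite (diff_comp gd Fd) /comp FE.
Qed.

End Gradient.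

(** * Gradients as vectors of the phase space *)

Section PhaseVector.
Context {R : realType}.
Implicit Types (v w z g h : phase R).

Definition phase_vec (x1 x2 q1 q2 : R) : phase R :=
  row_mx (\row_k [:: x1; x2]`_k) (\row_k [:: q1; q2]`_k).

Lemma ucoord_row (f g : 'rV[R]_2) k : ucoord k (row_mx f g) = f 0 k.
Proof. by rewrite /ucoord row_mxEl. Qed.

Lemma pcoord_row (f g : 'rV[R]_2) k : pcoord k (row_mx f g) = g 0 k.
Proof. by rewrite /pcoord row_mxEr. Qed.

Lemma phase_vecE x1 x2 q1 q2 :
  (ucoord 0 (phase_vec x1 x2 q1 q2) = x1) *
  (ucoord 1 (phase_vec x1 x2 q1 q2) = x2) *
  (pcoord 0 (phase_vec x1 x2 q1 q2) = q1) *
  (pcoord 1 (phase_vec x1 x2 q1 q2) = q2).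
Proof. by rewrite !ucoord_row !pcoord_row !mxE. Qed.

Lemma phase_coordD v w k : (ucoord k (v + w) = ucoord k v + ucoord k w) *
  (pcoord k (v + w) = pcoord k v + pcoord k w).
Proof. by rewrite /ucoord /pcoord !mxE. Qed.

Lemma phase_coordN v k : (ucoord k (- v) = - ucoord k v) *
  (pcoord k (- v) = - pcoord k v).
Proof. by rewrite /ucoord /pcoord !mxE. Qed.

Lemma phase_coordZ (a : R) v k : (ucoord k (a *: v) = a * ucoord k v) *
  (pcoord k (a *: v) = a * pcoord k v).
Proof. by rewrite /ucoord /pcoord !mxE. Qed.

Lemma phase_coord0 k :
  (ucoord k (0 : phase R) = 0) * (pcoord k (0 : phase R) = 0).
Proof. by rewrite /ucoord /pcoord !mxE. Qed.

(** Linearity rules alone, for gradients kept abstract; [phase_coordE] also evaluates explicit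
    vectors. *)
Definition phase_coordL :=
  (phase_coordD, phase_coordN, phase_coordZ, phase_coord0).

Definition phase_coordE := (phase_coordL, phase_vecE).

Lemma ord2P (P : 'I_2 -> Prop) : P 0 -> P 1 -> forall k, P k.
Proof.
move=> P0 P1 [[|[|//]] kP].
  by rewrite (_ : Ordinal _ = 0)//; exact: val_inj.
by rewrite (_ : Ordinal _ = 1)//; exact: val_inj.
Qed.

Lemma phaseP v w : ucoord 0 v = ucoord 0 w -> ucoord 1 v = ucoord 1 w ->
  pcoord 0 v = pcoord 0 w -> pcoord 1 v = pcoord 1 w -> v = w.
Proof.
move=> u0 u1 p0 p1; apply/rowP => i; rewrite -[i]splitK.
by case: (fintype.split i) => k /=; move: k; apply: ord2P.
Qed.

Lemma has_grad_ucoord0 z : has_grad (ucoord 0) z (phase_vec 1 0 0 0).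
Proof.
apply: (has_grad_eq (has_grad_coord _ z)).
by apply: phaseP; rewrite phase_vecE /ucoord /pcoord mxE.
Qed.

Lemma has_grad_ucoord1 z : has_grad (ucoord 1) z (phase_vec 0 1 0 0).
Proof.
apply: (has_grad_eq (has_grad_coord _ z)).
by apply: phaseP; rewrite phase_vecE /ucoord /pcoord mxE.
Qed.

Lemma has_grad_pcoord0 z : has_grad (pcoord 0) z (phase_vec 0 0 1 0).
Proof.
apply: (has_grad_eq (has_grad_coord _ z)).
by apply: phaseP; rewrite phase_vecE /ucoord /pcoord mxE.
Qed.

Lemma has_grad_pcoord1 z : has_grad (pcoord 1) z (phase_vec 0 0 0 1).
Proof.
apply: (has_grad_eq (has_grad_coord _ z)).
by apply: phaseP; rewrite phase_vecE /ucoord /pcoord mxE.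
Qed.

Definition poissonW z g h : R :=
  ucoord 0 z * (ucoord 0 g * pcoord 0 h - pcoord 0 g * ucoord 0 h) +
  ucoord 1 z * (ucoord 1 g * pcoord 1 h - pcoord 1 g * ucoord 1 h).

Lemma poissonWDl z g g' h :
  poissonW z (g + g') h = poissonW z g h + poissonW z g' h.
Proof. by rewrite /poissonW !phase_coordE; ring. Qed.

Lemma poissonWZl (a : R) z g h : poissonW z (a *: g) h = a * poissonW z g h.
Proof. by rewrite /poissonW !phase_coordE; ring. Qed.

Lemma poissonWC z g h : poissonW z g h = - poissonW z h g.
Proof. by rewrite /poissonW; ring. Qed.

Lemma poissonWxx z g : poissonW z g g = 0.
Proof. by rewrite /poissonW; ring. Qed.

Lemma poissonWDr z g h h' :
  poissonW z g (h + h') = poissonW z g h + poissonW z g h'.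
Proof. by rewrite /poissonW !phase_coordE; ring. Qed.

Lemma poissonWZr (a : R) z g h : poissonW z g (a *: h) = a * poissonW z g h.
Proof. by rewrite /poissonW !phase_coordE; ring. Qed.

Lemma poissonWNl z g h : poissonW z (- g) h = - poissonW z g h.
Proof. by rewrite /poissonW !phase_coordE; ring. Qed.

Lemma poissonWNr z g h : poissonW z g (- h) = - poissonW z g h.
Proof. by rewrite /poissonW !phase_coordE; ring. Qed.

Definition poissonWE :=
  (poissonWDl, poissonWDr, poissonWZl, poissonWZr, poissonWxx).

Lemma bracketW_grad (F G : phase R -> R) z g h :
  has_grad F z g -> has_grad G z h -> bracketW F G z = poissonW z g h.
Proof.
move=> Fg Gh; rewrite /bracketW.
transitivity (\sum_i \sum_j Wmx z i j * g 0 i * h 0 j).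
  apply: eq_bigr => i _; apply: eq_bigr => j _.
  by rewrite (has_grad_partial _ Fg) (has_grad_partial _ Gh).
have sum2 (f : 'I_2 -> R) : \sum_i f i = f 0 + f 1.
  by rewrite !big_ord_recl big_ord0 addr0; congr (_ + f _); exact: val_inj.
rewrite big_split_ord /= !sum2 !big_split_ord /= !sum2 /Wmx.
rewrite !(block_mxEul, block_mxEur, block_mxEdl, block_mxEdr) !mxE /=.
by rewrite /poissonW /ucoord /pcoord; ring.
Qed.

(** The Hamiltonian vector of a function with gradient [h], signed so that differentiating [F] along
    it gives the bracket of [F] with that function ([ham_vec_dot]). *)
Definition ham_vec z h : phase R :=
  phase_vec (ucoord 0 z * pcoord 0 h) (ucoord 1 z * pcoord 1 h)
    (- (ucoord 0 z * ucoord 0 h)) (- (ucoord 1 z * ucoord 1 h)).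

Lemma dotE v g : (v *m g^T) 0 0 =
  ucoord 0 v * ucoord 0 g + ucoord 1 v * ucoord 1 g +
  (pcoord 0 v * pcoord 0 g + pcoord 1 v * pcoord 1 g).
Proof.
rewrite mxE big_split_ord /= !big_ord_recl !big_ord0 !mxE !addr0.
by rewrite (_ : lift ord0 ord0 = 1)//; exact: val_inj.
Qed.

Lemma ham_vec_dot z g h : (ham_vec z h *m g^T) 0 0 = poissonW z g h.
Proof. by rewrite dotE !phase_coordE /poissonW; ring. Qed.

End PhaseVector.

(** * The spectral curve and the interpolating line *)

Definition generic_point (R : realType) (z : phase R) : Prop :=
  [/\ ucoord 0 z != ucoord 1 z, ucoord 0 z != 0 & ucoord 1 z != 0].

Section Interpolation.
Context {R : realType}.
Variables a1 a2 a3 : R.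
Implicit Types (z : phase R) (x y : R).

Local Notation s1 := (a1 + a2 + a3).
Local Notation s2 := (a1 * a2 + a1 * a3 + a2 * a3).
Local Notation s3 := (a1 * a2 * a3).

Local Notation phi := (phi a1 a2 a3).
Local Notation H1 := (H1 a1 a2 a3).
Local Notation H2 := (H2 a1 a2 a3).

Definition phi' x : R :=
  - 4 * ((a2 - x) * (a3 - x) + (a1 - x) * (a3 - x) + (a1 - x) * (a2 - x)).

Definition V1 z : R :=
  phi (ucoord 0 z) * pcoord 0 z / ((ucoord 0 z - ucoord 1 z) * ucoord 0 z) -
  phi (ucoord 1 z) * pcoord 1 z / ((ucoord 0 z - ucoord 1 z) * ucoord 1 z).

Definition V0 z : R :=
  ucoord 0 z * phi (ucoord 1 z) * pcoord 1 z
    / ((ucoord 0 z - ucoord 1 z) * ucoord 1 z) -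
  ucoord 1 z * phi (ucoord 0 z) * pcoord 0 z
    / ((ucoord 0 z - ucoord 1 z) * ucoord 0 z).

(* [B2], [B1], [B0] are [A2], [A1], [A0] rewritten through the coefficients of
   the identity [spectral_factor]; their gradients are then short. *)
Definition B2 z : R := - 4 * H1 z - V1 z ^+ 2.

Definition B1 z : R := B2 z * (ucoord 0 z + ucoord 1 z)
  + 4 * s1 * H1 z - 4 * H2 z - 2 * V1 z * V0 z.

Definition B0 z : R := 4 * s3 * H2 z / (ucoord 0 z * ucoord 1 z).

Lemma generic_point_sub z : generic_point z ->
  (ucoord 0 z - ucoord 1 z != 0) * (ucoord 1 z - ucoord 0 z != 0).
Proof. by case=> u12 _ _; split; rewrite subr_eq0 // eq_sym. Qed.

Lemma A2_B2 z : generic_point z -> A2 a1 a2 a3 z = B2 z.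
Proof.
move=> nz; have [u12 u21] := generic_point_sub nz; case: nz => _ u1 u2.
rewrite /A2 /B2 /V1 /H1 /=; field.
by rewrite u1 u2 u12 u21.
Qed.

Lemma A1_B1 z : generic_point z -> A1 a1 a2 a3 z = B1 z.
Proof.
move=> nz; have [u12 u21] := generic_point_sub nz; case: nz => _ u1 u2.
rewrite /A1 /B1 /B2 /V1 /V0 /H1 /H2 /=; field.
by rewrite u1 u2 u12 u21.
Qed.

Lemma A0_B0 z : generic_point z -> A0 a1 a2 a3 z = B0 z.
Proof.
move=> nz; have [u12 u21] := generic_point_sub nz; case: nz => _ u1 u2.
rewrite /A0 /B0 /H2 /=; field.
by rewrite u1 u2 u12 u21.
Qed.

(** [B2], [B1], [B0] match the coefficients of [x^4], [x^3] and [1]. The remaining difference is [x]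
    times a polynomial of degree at most one, and it vanishes at the distinct nonzero points [u_1],
    [u_2], because [phi_k (H1 u_k + H2) = (phi_k p_k)^2] and [phi_k p_k = u_k L(u_k)]. *)
Lemma spectral_factor z x : generic_point z ->
  phi x * (H1 z * x + H2 z) - (x * (V1 z * x + V0 z)) ^+ 2 =
  (x - ucoord 0 z) * (x - ucoord 1 z) *
    (B2 z * x ^+ 2 + B1 z * x + B0 z).
Proof.
move=> nz; have [u12 u21] := generic_point_sub nz; case: nz => _ u1 u2.
rewrite /B0 /B1 /B2 /V1 /V0 /H1 /H2  /Defs.phi /=; field.
by rewrite u1 u2 u12 u21.
Qed.

(** Valid at every [z], since [invrN] covers zero denominators too; [has_grad_ptilde] can thus
    rewrite an equality of functions. *)
Lemma ptildeE z x :
  ptilde a1 a2 a3 z x = - (x / phi x) * (V1 z * x + V0 z).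
Proof.
rewrite /ptilde /V1 /V0 /=.
have -> : (ucoord 1 z - ucoord 0 z) * ucoord 1 z
  = - ((ucoord 0 z - ucoord 1 z) * ucoord 1 z) by ring.
by rewrite invrN; ring.
Qed.

Definition gradV1 z : phase R :=
  let u1 := ucoord 0 z in let u2 := ucoord 1 z in
  let p1 := pcoord 0 z in let p2 := pcoord 1 z in
  let d := u1 - u2 in
  phase_vec
    (phi' u1 * p1 / (d * u1) - phi u1 * p1 / (d ^+ 2 * u1)
      - phi u1 * p1 / (d * u1 ^+ 2) + phi u2 * p2 / (d ^+ 2 * u2))
    (phi u1 * p1 / (d ^+ 2 * u1) - phi' u2 * p2 / (d * u2)
      + phi u2 * p2 / (d * u2 ^+ 2) - phi u2 * p2 / (d ^+ 2 * u2))
    (phi u1 / (d * u1)) (- (phi u2 / (d * u2))).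

Definition gradV0 z : phase R :=
  let u1 := ucoord 0 z in let u2 := ucoord 1 z in
  let p1 := pcoord 0 z in let p2 := pcoord 1 z in
  let d := u1 - u2 in
  phase_vec
    (- u2 * (phi' u1 * p1 / (d * u1) - phi u1 * p1 / (d ^+ 2 * u1)
      - phi u1 * p1 / (d * u1 ^+ 2)) - phi u2 * p2 / d ^+ 2)
    (u1 * (phi' u2 * p2 / (d * u2) + phi u2 * p2 / (d ^+ 2 * u2)
      - phi u2 * p2 / (d * u2 ^+ 2)) - phi u1 * p1 / d ^+ 2)
    (- u2 * phi u1 / (d * u1)) (u1 * phi u2 / (d * u2)).

Definition gradH1 z : phase R :=
  let u1 := ucoord 0 z in let u2 := ucoord 1 z in
  let p1 := pcoord 0 z in let p2 := pcoord 1 z in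
  let d := u1 - u2 in
  phase_vec
    (phi' u1 * p1 ^+ 2 / d - (phi u1 * p1 ^+ 2 - phi u2 * p2 ^+ 2) / d ^+ 2)
    (- (phi' u2 * p2 ^+ 2 / d) + (phi u1 * p1 ^+ 2 - phi u2 * p2 ^+ 2) / d ^+ 2)
    (2 * phi u1 * p1 / d) (- (2 * phi u2 * p2 / d)).

(** Differentiating [phi_2 p_2^2 = H1 u_2 + H2] in [u_1] or [p_1] gives [dH2 = - u_2 dH1] in these
    directions, and symmetrically with [- u_1]. In this form the bracket of [H1] and [H2] vanishes
    on each pair [(u_k, p_k)] separately. *)
Definition gradH2 z : phase R :=
  phase_vec (- ucoord 1 z * ucoord 0 (gradH1 z))
    (- ucoord 0 z * ucoord 1 (gradH1 z))
    (- ucoord 1 z * pcoord 0 (gradH1 z)) (- ucoord 0 z * pcoord 1 (gradH1 z)).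

Lemma has_grad_phi (F : phase R -> R) z g : has_grad F z g ->
  has_grad (fun w : phase R => phi (F w)) z (phi' (F z) *: g).
Proof.
move=> Fg; rewrite /Defs.phi.
apply: has_grad_eq.
  repeat first [exact: Fg | exact: has_grad_cst | apply: has_gradN
               | apply: has_gradD | apply: has_gradM].
by apply: phaseP; rewrite !phase_coordE /phi'; ring.
Qed.

Ltac solve_has_grad := repeat first
  [ apply: has_grad_phi | apply: has_gradD | apply: has_gradN
  | apply: has_gradM | apply: has_grad_sqr | apply: has_gradV
  | exact: has_grad_ucoord0 | exact: has_grad_ucoord1
  | exact: has_grad_pcoord0 | exact: has_grad_pcoord1
  | exact: has_grad_cst ].

(** Identities closed after this step hold for arbitrary values of [phi] and [phi'] at [u_1], [u_2];
    abstracting them keeps the [field] goals small. *)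
Ltac generalize_phi z :=
  move: (phi' (ucoord 0 z)) (phi' (ucoord 1 z)) => f1' f2';
  move: (phi (ucoord 0 z)) (phi (ucoord 1 z)) => f1 f2.

Lemma has_gradH1 z : generic_point z -> has_grad H1 z (gradH1 z).
Proof.
move=> nz; have [u12 u21] := generic_point_sub nz; case: nz => _ u1 u2.
rewrite /H1; apply: has_grad_eq; first by solve_has_grad.
by apply: phaseP; rewrite !phase_coordE /=;
  generalize_phi z; field; rewrite u12 u21.
Qed.

Lemma has_gradH2 z : generic_point z -> has_grad H2 z (gradH2 z).
Proof.
move=> nz; have [u12 u21] := generic_point_sub nz; case: nz => _ u1 u2.
rewrite /H2; apply: has_grad_eq; first by solve_has_grad.
by apply: phaseP; rewrite /gradH2 !phase_coordE /=;
  generalize_phi z; field; rewrite u12 u21.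
Qed.

Lemma has_gradV1 z : generic_point z -> has_grad V1 z (gradV1 z).
Proof.
move=> nz; have [u12 u21] := generic_point_sub nz; case: nz => _ u1 u2.
rewrite /V1; apply: has_grad_eq; first by solve_has_grad; rewrite mulf_neq0.
by apply: phaseP; rewrite !phase_coordE /=;
  generalize_phi z; field; rewrite u12 u1 u2.
Qed.

Lemma has_gradV0 z : generic_point z -> has_grad V0 z (gradV0 z).
Proof.
move=> nz; have [u12 u21] := generic_point_sub nz; case: nz => _ u1 u2.
rewrite /V0; apply: has_grad_eq; first by solve_has_grad; rewrite mulf_neq0.
by apply: phaseP; rewrite !phase_coordE /=;
  generalize_phi z; field; rewrite u12 u1 u2.
Qed.

(** * Brackets of the coefficients *)

Definition e1 z := ucoord 0 z + ucoord 1 z.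
Definition e2 z := ucoord 0 z * ucoord 1 z.

Definition grade1 z : phase R := phase_vec 1 1 0 0.
Definition grade2 z : phase R := phase_vec (ucoord 1 z) (ucoord 0 z) 0 0.

(** Same mechanism as for [H1] and [H2]: each relation [phi_k p_k / u_k = V1 u_k + V0] involves one
    pair [(u_k, p_k)], so [dV0 = - u_2 dV1] along the first pair and [dV0 = - u_1 dV1] along the
    second. *)
Lemma poissonW_V1_V0 z : generic_point z ->
  poissonW z (gradV1 z) (gradV0 z) = 0.
Proof.
move=> nz; have [u12 u21] := generic_point_sub nz; case: nz => _ u1 u2.
rewrite /poissonW /gradV1 /gradV0 !phase_vecE.
by generalize_phi z; field; rewrite u12 u1 u2.
Qed.

Lemma poissonW_H1_H2 z : poissonW z (gradH1 z) (gradH2 z) = 0.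
Proof. by rewrite /poissonW /gradH2 !phase_vecE; ring. Qed.

(** Because [phi_k p_k = u_k L(u_k)], the brackets of [e1], [e2] with [H1], [H2] reduce to divided
    differences of [x^2 L(x)], [x L(x)] and [L(x)] at [u_1], [u_2]. *)
Lemma poissonW_e1_H1 z : generic_point z ->
  poissonW z (grade1 z) (gradH1 z)
    = 2 * (V1 z * (e1 z ^+ 2 - e2 z) + V0 z * e1 z).
Proof.
move=> nz; have [u12 u21] := generic_point_sub nz; case: nz => _ u1 u2.
rewrite /poissonW /gradH1 /grade1 !phase_vecE /e1 /e2 /V1 /V0.
by generalize_phi z; field; rewrite u12 u1 u2.
Qed.

Lemma poissonW_e1_H2 z : generic_point z ->
  poissonW z (grade1 z) (gradH2 z) = - 2 * e2 z * (V1 z * e1 z + V0 z).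
Proof.
move=> nz; have [u12 u21] := generic_point_sub nz; case: nz => _ u1 u2.
rewrite /poissonW /gradH2 /gradH1 /grade1 !phase_vecE /e1 /e2 /V1 /V0.
by generalize_phi z; field; rewrite u12 u1 u2.
Qed.

Lemma poissonW_e2_H1 z : generic_point z ->
  poissonW z (grade2 z) (gradH1 z) = 2 * e2 z * (V1 z * e1 z + V0 z).
Proof.
move=> nz; have [u12 u21] := generic_point_sub nz; case: nz => _ u1 u2.
rewrite /poissonW /gradH2 /gradH1 /grade2 !phase_vecE /e1 /e2 /V1 /V0.
by generalize_phi z; field; rewrite u12 u1 u2.
Qed.

Lemma poissonW_e2_H2 z : generic_point z ->
  poissonW z (grade2 z) (gradH2 z) = - 2 * e2 z ^+ 2 * V1 z.
Proof.
move=> nz; have [u12 u21] := generic_point_sub nz; case: nz => _ u1 u2.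
rewrite /poissonW /gradH2 /gradH1 /grade2 !phase_vecE /e1 /e2 /V1 /V0.
by generalize_phi z; field; rewrite u12 u1 u2.
Qed.

(** Since [{u_k, phi_k p_k / u_k} = phi_k], this is [(phi_1 - phi_2) / (u_1 - u_2)]. The next three
    are likewise antisymmetric polynomials divided by [u_1 - u_2], which is where the explicit cubic
    [phi] enters. *)
Lemma poissonW_e1_V1 z : generic_point z ->
  poissonW z (grade1 z) (gradV1 z) = 4 * (s1 * e1 z - s2 - e1 z ^+ 2 + e2 z).
Proof.
move=> nz; have [u12 u21] := generic_point_sub nz; case: nz => _ u1 u2.
rewrite /poissonW /gradV1 /grade1 !phase_vecE /e1 /e2 /Defs.phi.
by field; rewrite u12 u1 u2.
Qed.

Lemma poissonW_e1_V0 z : generic_point z ->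
  poissonW z (grade1 z) (gradV0 z) = 4 * (s3 - s1 * e2 z + e1 z * e2 z).
Proof.
move=> nz; have [u12 u21] := generic_point_sub nz; case: nz => _ u1 u2.
rewrite /poissonW /gradV0 /grade1 !phase_vecE /e1 /e2 /Defs.phi.
by field; rewrite u12 u1 u2.
Qed.

Lemma poissonW_e2_V1 z : generic_point z ->
  poissonW z (grade2 z) (gradV1 z) = - 4 * (s3 - s1 * e2 z + e1 z * e2 z).
Proof.
move=> nz; have [u12 u21] := generic_point_sub nz; case: nz => _ u1 u2.
rewrite /poissonW /gradV1 /grade2 !phase_vecE /e1 /e2 /Defs.phi.
by field; rewrite u12 u1 u2.
Qed.

Lemma poissonW_e2_V0 z : generic_point z ->
  poissonW z (grade2 z) (gradV0 z) = 4 * (s3 * e1 z - s2 * e2 z + e2 z ^+ 2).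
Proof.
move=> nz; have [u12 u21] := generic_point_sub nz; case: nz => _ u1 u2.
rewrite /poissonW /gradV0 /grade2 !phase_vecE /e1 /e2 /Defs.phi.
by field; rewrite u12 u1 u2.
Qed.

(** Bracket [spectral_factor] with [V1] and put [x = u_k]: the term in [L] drops out since [V1] and
    [V0] commute, and [{H1,V1} x + {H2,V1}] is found to be [- Utilde(x)] modulo
    [(x - u_1)(x - u_2)]. With [V0] in place of [V1] it is [(e1 - x) Utilde(x)]. The coefficients of
    these remainders are the right-hand sides of this lemma and the next three. *)
Lemma poissonW_H1_V1 z : generic_point z ->
  poissonW z (gradH1 z) (gradV1 z) = - (B1 z + B2 z * e1 z).
Proof.
move=> nz; have [u12 u21] := generic_point_sub nz; case: nz => _ u1 u2.
rewrite /poissonW /gradV1 /gradH1 !phase_vecE /e1 /B1 /B2.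
rewrite /Defs.H1 /Defs.H2 /V1 /V0 /phi' /Defs.phi /=.
by field; rewrite u12 u1 u2 u21.
Qed.

Lemma poissonW_H1_V0 z : generic_point z ->
  poissonW z (gradH1 z) (gradV0 z) = B2 z * e2 z - B0 z.
Proof.
move=> nz; have [u12 u21] := generic_point_sub nz; case: nz => _ u1 u2.
rewrite /poissonW /gradV0 /gradH1 !phase_vecE /e2 /B0 /B2.
rewrite /Defs.H1 /Defs.H2 /V1 /V0 /phi' /Defs.phi /=.
by field; rewrite u12 u1 u2 u21.
Qed.

Lemma poissonW_H2_V1 z : generic_point z ->
  poissonW z (gradH2 z) (gradV1 z) = B2 z * e2 z - B0 z.
Proof.
move=> nz; have [u12 u21] := generic_point_sub nz; case: nz => _ u1 u2.
rewrite /poissonW /gradV1 /gradH2 /gradH1 !phase_vecE /e2 /B0 /B2.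
rewrite /Defs.H1 /Defs.H2 /V1 /V0 /phi' /Defs.phi /=.
by field; rewrite u12 u1 u2 u21.
Qed.

Lemma poissonW_H2_V0 z : generic_point z ->
  poissonW z (gradH2 z) (gradV0 z) = B1 z * e2 z + B0 z * e1 z.
Proof.
move=> nz; have [u12 u21] := generic_point_sub nz; case: nz => _ u1 u2.
rewrite /poissonW /gradV0 /gradH2 /gradH1 !phase_vecE /e1 /e2.
rewrite /B0 /B1 /B2.
rewrite /Defs.H1 /Defs.H2 /V1 /V0 /phi' /Defs.phi /=.
by field; rewrite u12 u1 u2 u21.
Qed.

(** * Gradients of the coefficients of [Utilde] and their brackets *)

Definition gradB2 z : phase R :=
  (- 4) *: gradH1 z + (- 2 * V1 z) *: gradV1 z.

Definition gradB1 z : phase R :=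
  e1 z *: gradB2 z + B2 z *: grade1 z + (4 * s1) *: gradH1 z
  + (- 4) *: gradH2 z + (- 2 * V1 z) *: gradV0 z + (- 2 * V0 z) *: gradV1 z.

Definition gradB0 z : phase R :=
  (4 * s3 / e2 z) *: gradH2 z + (- B0 z / e2 z) *: grade2 z.

Lemma e2_neq0 z : generic_point z -> e2 z != 0.
Proof. by case=> _ u1 u2; rewrite mulf_neq0. Qed.

Lemma has_grade1 z : has_grad e1 z (grade1 z).
Proof.
apply: has_grad_eq.
  by apply: has_gradD; [exact: has_grad_ucoord0|exact: has_grad_ucoord1].
by apply: phaseP; rewrite !phase_coordE; ring.
Qed.

Lemma has_grade2 z : has_grad e2 z (grade2 z).
Proof.
apply: has_grad_eq.
  by apply: has_gradM; [exact: has_grad_ucoord0|exact: has_grad_ucoord1].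
by apply: phaseP; rewrite !phase_coordE; ring.
Qed.

Lemma has_gradB2 z : generic_point z -> has_grad B2 z (gradB2 z).
Proof.
move=> gz; apply: has_grad_eq.
  apply: has_gradD.
    by apply: has_gradM; [exact: has_grad_cst|exact: has_gradH1].
  by apply: has_gradN; apply: has_grad_sqr; exact: has_gradV1.
rewrite /gradB2; move: (gradH1 z) (gradV1 z) => gH gV.
by apply: phaseP; rewrite !phase_coordL; ring.
Qed.

Lemma has_gradB1 z : generic_point z -> has_grad B1 z (gradB1 z).
Proof.
move=> gz; apply: has_grad_eq.
  apply: has_gradD; [apply: has_gradD; [apply: has_gradD|]|].
  - by apply: has_gradM; [exact: has_gradB2|exact: has_grade1].
  - by apply: has_gradM; [exact: has_grad_cst|exact: has_gradH1].
  - apply: has_gradN.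
    by apply: has_gradM; [exact: has_grad_cst|exact: has_gradH2].
  - apply: has_gradN; apply: has_gradM; last exact: has_gradV0.
    by apply: has_gradM; [exact: has_grad_cst|exact: has_gradV1].
rewrite /gradB1 /e1; move: (gradB2 z) (grade1 z) => g2 ge1.
by apply: phaseP; rewrite !phase_coordL; ring.
Qed.

Lemma has_gradB0 z : generic_point z -> has_grad B0 z (gradB0 z).
Proof.
move=> gz; have e20 := e2_neq0 gz; apply: has_grad_eq.
  apply: has_gradM.
    by apply: has_gradM; [exact: has_grad_cst|exact: has_gradH2].
  by apply: has_gradV => //; exact: has_grade2.
rewrite /gradB0 /B0 -/(e2 z); move: (gradH2 z) (grade2 z) => gH ge.
by apply: phaseP; rewrite !phase_coordL; field.
Qed.

Lemma poissonW_commuting z : generic_point z ->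
  (poissonW z (gradV1 z) (gradV0 z) = 0) *
  (poissonW z (gradV0 z) (gradV1 z) = 0) *
  (poissonW z (gradH1 z) (gradH2 z) = 0) *
  (poissonW z (gradH2 z) (gradH1 z) = 0) *
  (poissonW z (grade1 z) (grade2 z) = 0).
Proof.
move=> gz; have VV := poissonW_V1_V0 gz.
have HH := poissonW_H1_H2 z.
do !split => //; try by rewrite poissonWC ?VV ?HH oppr0.
by rewrite /poissonW !phase_vecE; ring.
Qed.

(* The factor [4 * (s1 * (x + y) - ...)] is [(phi x - phi y) / (x - y)]. *)
Lemma poissonW_Utilde_interp z x y : generic_point z ->
  poissonW z (x ^+ 2 *: gradB2 z + x *: gradB1 z + gradB0 z)
    (y *: gradV1 z + gradV0 z)
  = - (4 * (s1 * (x + y) - s2 - (x ^+ 2 + x * y + y ^+ 2)))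
      * (B2 z * y ^+ 2 + B1 z * y + B0 z)
    + phi y * (B2 z * (x + y) + B1 z)
    + 4 * (B2 z * x ^+ 2 + B1 z * x + B0 z) * (e1 z * y - e2 z - y ^+ 2).
Proof.
move=> gz; have e20 := e2_neq0 gz.
rewrite /gradB2 /gradB1 /gradB0 /gradB2 !poissonWE.
rewrite !(poissonW_commuting gz) (poissonW_e1_V1 gz) (poissonW_e1_V0 gz).
rewrite (poissonW_e2_V1 gz) (poissonW_e2_V0 gz).
rewrite (poissonW_H1_V1 gz) (poissonW_H1_V0 gz).
rewrite (poissonW_H2_V1 gz) (poissonW_H2_V0 gz).
rewrite /Defs.phi; move: (B2 z) (B1 z) (B0 z) (e1 z) (e2 z) e20.
by move=> b2 b1 b0 E1 E2 E20; field.
Qed.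

(* By Vieta this is [{Utilde(x), Utilde(y)} = 0] at the two roots [x], [y],
   after division by [x - y] and multiplication by [B2]. *)
Lemma poissonW_Utilde z : generic_point z ->
  poissonW z (gradB2 z) (gradB1 z) * B0 z
  - poissonW z (gradB2 z) (gradB0 z) * B1 z
  + poissonW z (gradB1 z) (gradB0 z) * B2 z = 0.
Proof.
move=> gz; have e20 := e2_neq0 gz; have T := poissonW_commuting gz.
rewrite /gradB1 /gradB0 /gradB2 !poissonWE.
(* Each bracket is turned into the order in which it is tabulated above. *)
rewrite ?[poissonW z (gradV1 z) (gradH1 z)]poissonWC.
rewrite ?[poissonW z (gradV1 z) (gradH2 z)]poissonWC.
rewrite ?[poissonW z (gradV0 z) (gradH1 z)]poissonWC.
rewrite ?[poissonW z (gradV0 z) (gradH2 z)]poissonWC.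
rewrite ?[poissonW z (_ z) (grade1 z)]poissonWC.
rewrite ?[poissonW z (gradH1 z) (grade2 z)]poissonWC.
rewrite ?[poissonW z (gradV1 z) (grade2 z)]poissonWC.
rewrite ?[poissonW z (gradV0 z) (grade2 z)]poissonWC.
rewrite ?[poissonW z (gradH2 z) (grade2 z)]poissonWC !T.
rewrite ?(poissonW_e1_V1 gz) ?(poissonW_e1_V0 gz).
rewrite ?(poissonW_e2_V1 gz) ?(poissonW_e2_V0 gz).
rewrite ?(poissonW_H1_V1 gz) ?(poissonW_H1_V0 gz).
rewrite ?(poissonW_H2_V1 gz) ?(poissonW_H2_V0 gz).
rewrite ?(poissonW_e1_H1 gz) ?(poissonW_e1_H2 gz).
rewrite ?(poissonW_e2_H1 gz) ?(poissonW_e2_H2 gz).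
move: (B2 z) (B1 z) (B0 z) (V1 z) (V0 z) (e1 z) (e2 z) e20.
by move=> b2 b1 b0 v1 v0 E1 E2 E20; field.
Qed.
(** * Brackets of the roots *)

Definition gradU z x : phase R := x ^+ 2 *: gradB2 z + x *: gradB1 z + gradB0 z.

(** Implicit differentiation of [Utilde(r) = 0]; the slope of [Utilde] at the root stays as a factor
    instead of being inverted. *)
Lemma root_grad (r : phase R -> R) z g : generic_point z ->
  (\forall w \near z, B2 w * r w ^+ 2 + B1 w * r w + B0 w = 0) ->
  has_grad r z g -> (2 * B2 z * r z + B1 z) *: g = - gradU z (r z).
Proof.
move=> gz r0 rg; apply/eqP; rewrite -addr_eq0; apply/eqP.
apply: (has_grad_near0 r0); apply: has_grad_eq.
  apply: has_gradD; last exact: (has_gradB0 gz).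
  apply: has_gradD; last exact: (has_gradM (has_gradB1 gz) rg).
  exact: (has_gradM (has_gradB2 gz) (has_grad_sqr rg)).
rewrite /gradU; move: (gradB2 z) (gradB1 z) (gradB0 z) => g2 g1 g0.
by apply: phaseP; rewrite !phase_coordL; ring.
Qed.

Lemma vieta2 (b2 b1 b0 x y : R) : x != y ->
  b2 * x ^+ 2 + b1 * x + b0 = 0 -> b2 * y ^+ 2 + b1 * y + b0 = 0 ->
  (b1 = - b2 * (x + y)) * (b0 = b2 * (x * y)).
Proof.
rewrite -subr_eq0 => xy Ux Uy.
have b1E : b1 = - b2 * (x + y).
  apply: (mulfI xy); apply/eqP; rewrite -subr_eq0; apply/eqP.
  transitivity (b2 * x ^+ 2 + b1 * x + b0 - (b2 * y ^+ 2 + b1 * y + b0)).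
    by ring.
  by rewrite Ux Uy subrr.
split=> //; rewrite -[RHS]addr0 -Ux b1E; ring.
Qed.

Section RootPair.
Variables (z gX gY : phase R) (X Y : R).
Hypothesis gz : generic_point z.
Hypothesis XY : X != Y.
Hypothesis b20 : B2 z != 0.
Hypothesis UX : B2 z * X ^+ 2 + B1 z * X + B0 z = 0.
Hypothesis UY : B2 z * Y ^+ 2 + B1 z * Y + B0 z = 0.
Hypothesis gXE : (2 * B2 z * X + B1 z) *: gX = - gradU z X.

(** By Vieta the slope of [Utilde] at [X] is a nonzero multiple of [X - Y], so it can be
    cancelled. *)
Let slopeX : 2 * B2 z * X + B1 z = B2 z * (X - Y).
Proof. by rewrite !(vieta2 XY UX UY); ring. Qed.

Let slopeX0 : B2 z * (X - Y) != 0.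
Proof. by rewrite mulf_neq0// subr_eq0. Qed.

Let poisson_gX h :
  B2 z * (X - Y) * poissonW z gX h = - poissonW z (gradU z X) h.
Proof.
by rewrite -slopeX -poissonWZl gXE poissonWNl.
Qed.

(** The second argument is the gradient of [L(x)] with [x] frozen at [X]. For [x = y = X],
    [poissonW_Utilde_interp] retains only [phi X] times the slope. *)
Lemma poissonW_root_interp :
  poissonW z gX (X *: gradV1 z + gradV0 z) = - phi X.
Proof.
apply: (mulfI slopeX0); rewrite poisson_gX poissonW_Utilde_interp// UX.
by rewrite mulr0 mulr0 mul0r !addr0 add0r !(vieta2 XY UX UY); ring.
Qed.

(** For [x = X], [y = Y] the surviving term has the factor [B2 (X + Y) + B1], zero by Vieta. *)
Lemma poissonW_root_interp_other :
  poissonW z gX (Y *: gradV1 z + gradV0 z) = 0.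
Proof.
apply: (mulfI slopeX0); rewrite poisson_gX poissonW_Utilde_interp// UX UY.
by rewrite !(vieta2 XY UX UY); ring.
Qed.

Hypothesis gYE : (2 * B2 z * Y + B1 z) *: gY = - gradU z Y.

Lemma poissonW_roots : poissonW z gX gY = 0.
Proof.
have slopeY : 2 * B2 z * Y + B1 z = B2 z * (Y - X).
  by rewrite !(vieta2 XY UX UY); ring.
have slopeY0 : B2 z * (Y - X) != 0 by rewrite mulf_neq0// subr_eq0 eq_sym.
have poisson_gY h :
    B2 z * (Y - X) * poissonW z h gY = - poissonW z h (gradU z Y).
  by rewrite -slopeY -poissonWZr gYE poissonWNr.
apply: (mulfI slopeX0); rewrite poisson_gX mulr0.
apply: (mulfI slopeY0); rewrite mulrN poisson_gY opprK mulr0.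
(* The factors [B2] and [X - Y] introduced here are those separating the bracket of [Utilde(X)] and
   [Utilde(Y)] from [poissonW_Utilde]. *)
apply: (mulfI b20); rewrite mulr0.
rewrite -(mulr0 (X - Y)) -(poissonW_Utilde gz) /gradU.
move: (gradB2 z) (gradB1 z) (gradB0 z) => g2 g1 g0.
rewrite !(vieta2 XY UX UY) !poissonWE.
by rewrite (poissonWC z g1 g2) (poissonWC z g0 g2) (poissonWC z g0 g1); ring.
Qed.

End RootPair.
(** * Hamiltonians and the Abel quadrature *)

(** The coefficient of [g] may stay existential: in the brackets computed later its contribution
    vanishes, because the roots commute with each other and each commutes with [L] at the other
    root. *)
Lemma has_grad_ptilde (r : phase R -> R) z g : generic_point z ->
  phi (r z) != 0 -> has_grad r z g ->
  exists c, has_grad (fun w => ptilde a1 a2 a3 w (r w)) z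
    (c *: g + (- (r z / phi (r z))) *: (r z *: gradV1 z + gradV0 z)).
Proof.
move=> gz phi0 rg.
(* The witness is the derivative in [x] of [- (x / phi x) (V1 x + V0)] at [x = r z]. *)
exists ((V1 z * r z + V0 z) *
  (r z * phi' (r z) / phi (r z) ^+ 2 - (phi (r z))^-1)
  - r z / phi (r z) * V1 z).
rewrite (_ : (fun w => _) =
  fun w => - (r w / phi (r w)) * (V1 w * r w + V0 w)); last first.
  by apply/funext => w; rewrite ptildeE.
have gV1 := has_gradV1 gz; have gV0 := has_gradV0 gz.
have gq := has_gradM rg (has_gradV phi0 (has_grad_phi rg)).
have gL := has_gradD (has_gradM gV1 rg) gV0.
apply: (has_grad_eq (has_gradM (has_gradN gq) gL)).
move: (gradV1 z) (gradV0 z) (phi' (r z)) (phi (r z)) phi0 => w1 w0 d f f0.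
by apply: phaseP; rewrite !phase_coordL; field.
Qed.

(** The two relations form a linear system in [h1], [h2] with determinant [u_1 - u_2], whose
    solution is given by the formulas for [H1] and [H2]. *)
Lemma spectral_H w (h1 h2 : R) : ucoord 0 w != ucoord 1 w ->
  (forall k, phi (ucoord k w) * pcoord k w ^+ 2 = h1 * ucoord k w + h2) ->
  H1 w = h1 /\ H2 w = h2.
Proof.
move=> u12 hk; have u12' : ucoord 0 w - ucoord 1 w != 0 by rewrite subr_eq0.
have u21 : ucoord 1 w - ucoord 0 w != 0 by rewrite subr_eq0 eq_sym.
rewrite /Defs.H1 /Defs.H2 /= -![ucoord _ w * phi _ * _]mulrA !hk.
by split; field; rewrite u12' u21.
Qed.

Lemma H_spectral w k : generic_point w ->
  phi (ucoord k w) * pcoord k w ^+ 2 = H1 w * ucoord k w + H2 w.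
Proof.
move=> /generic_point_sub[u12 u21]; rewrite /Defs.H1 /Defs.H2 /=.
by move: k; apply: ord2P; field; rewrite u12 u21.
Qed.

Lemma ptilde_spectral z x : generic_point z -> phi x != 0 ->
  B2 z * x ^+ 2 + B1 z * x + B0 z = 0 ->
  phi x * ptilde a1 a2 a3 z x ^+ 2 = H1 z * x + H2 z.
Proof.
move=> gz phi0 Ux; have := spectral_factor x gz.
rewrite Ux mulr0 => /eqP; rewrite subr_eq0 => /eqP sq.
apply: (mulfI phi0); rewrite sq ptildeE.
by move: (phi x) phi0 => f f0; field.
Qed.

(** Abstract in [q] and [p] so as to serve both for [(u_k, p_k)] and for their images; [c] collects
    every multiple of [gq], which disappears in brackets with commuting positions. *)
Lemma spectral_grad (q p : phase R -> R) z gq gp : generic_point z ->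
  (\forall w \near z, phi (q w) * p w ^+ 2 = H1 w * q w + H2 w) ->
  has_grad q z gq -> has_grad p z gp ->
  exists c, c *: gq + (2 * (phi (q z) * p z)) *: gp
    = q z *: gradH1 z + gradH2 z.
Proof.
move=> gz rel qg pg; exists (phi' (q z) * p z ^+ 2 - H1 z).
apply/eqP; rewrite -subr_eq0; apply/eqP.
have rel0 : \forall w \near z,
    phi (q w) * p w ^+ 2 + - (H1 w * q w + H2 w) = 0.
  by apply: filterS rel => w ->; rewrite subrr.
have gH1 := has_gradH1 gz; have gH2 := has_gradH2 gz.
have gF := has_gradD (has_gradM (has_grad_phi qg) (has_grad_sqr pg))
  (has_gradN (has_gradD (has_gradM gH1 qg) gH2)).
rewrite -(has_grad_near0 rel0 gF).
move: (gradH1 z) (gradH2 z) => w1 w2.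
by apply: phaseP; rewrite !phase_coordL; ring.
Qed.

(** Bracketing [q_i] with relation [k] leaves [q_k {q_i,H1} + {q_i,H2} = 2 y_k q_k delta_ik]. For
    each [i] this is a linear system of determinant [q_0 - q_1], which gives both brackets. *)
Lemma poissonW_abel z (g0 g1 p0 p1 G1 G2 : phase R) (q0 q1 y0 y1 c0 c1 : R) :
  q0 != q1 -> y0 != 0 -> y1 != 0 ->
  poissonW z g0 g1 = 0 ->
  poissonW z g0 p0 = q0 -> poissonW z g0 p1 = 0 ->
  poissonW z g1 p0 = 0 -> poissonW z g1 p1 = q1 ->
  c0 *: g0 + (2 * y0) *: p0 = q0 *: G1 + G2 ->
  c1 *: g1 + (2 * y1) *: p1 = q1 *: G1 + G2 ->
  poissonW z g0 G1 / y0 + poissonW z g1 G1 / y1 = 2 /\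
  poissonW z g0 G2 / y0 + poissonW z g1 G2 / y1 = 0.
Proof.
rewrite -subr_eq0 => q01 y00 y10 g01 g0p0 g0p1 g1p0 g1p1 r0 r1.
have g10 : poissonW z g1 g0 = 0 by rewrite poissonWC g01 oppr0.
have e00 := congr1 (poissonW z g0) r0; have e01 := congr1 (poissonW z g0) r1.
have e10 := congr1 (poissonW z g1) r0; have e11 := congr1 (poissonW z g1) r1.
rewrite !poissonWE g01 ?g0p0 ?g0p1 in e00 e01.
rewrite !poissonWE g10 ?g1p0 ?g1p1 in e10 e11.
have G01 : poissonW z g0 G1 = 2 * y0 * q0 / (q0 - q1).
  apply: (mulIf q01); rewrite divfK//.
  transitivity (q0 * poissonW z g0 G1 + poissonW z g0 G2 -
    (q1 * poissonW z g0 G1 + poissonW z g0 G2)); first by ring.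
  by rewrite -e00 -e01; ring.
have G11 : poissonW z g1 G1 = - (2 * y1 * q1) / (q0 - q1).
  apply: (mulIf q01); rewrite divfK//.
  transitivity (q0 * poissonW z g1 G1 + poissonW z g1 G2 -
    (q1 * poissonW z g1 G1 + poissonW z g1 G2)); first by ring.
  by rewrite -e10 -e11; ring.
have G02 : poissonW z g0 G2 = - q1 * poissonW z g0 G1.
  by apply/eqP; rewrite mulNr -addr_eq0 addrC -e01 !mulr0 addr0.
have G12 : poissonW z g1 G2 = - q0 * poissonW z g1 G1.
  by apply/eqP; rewrite mulNr -addr_eq0 addrC -e10 !mulr0 addr0.
by rewrite G02 G12 G01 G11; split; field; rewrite q01 y00 y10.
Qed.

Lemma gradH2E z :
  (ucoord 0 (gradH2 z) = - ucoord 1 z * ucoord 0 (gradH1 z)) *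
  (ucoord 1 (gradH2 z) = - ucoord 0 z * ucoord 1 (gradH1 z)) *
  (pcoord 0 (gradH2 z) = - ucoord 1 z * pcoord 0 (gradH1 z)) *
  (pcoord 1 (gradH2 z) = - ucoord 0 z * pcoord 1 (gradH1 z)).
Proof. by rewrite /gradH2 !phase_vecE. Qed.

Lemma ham_span z v : generic_point z ->
  (forall k, phi (ucoord k z) * pcoord k z != 0) ->
  (v *m (gradH1 z)^T) 0 0 = 0 -> (v *m (gradH2 z)^T) 0 0 = 0 ->
  exists c1 c2 : R, v = c1 *: ham_vec z (gradH1 z) + c2 *: ham_vec z (gradH2 z).
Proof.
move=> gz y0; have [u12 _] := generic_point_sub gz; case: gz => _ u10 u20.
rewrite !dotE !gradH2E /ham_vec !gradH2E.
set h := gradH1 z.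
have p10 : pcoord 0 h != 0.
  rewrite /h phase_vecE -[2 * _ * _]mulrA.
  by rewrite mulf_neq0 ?invr_eq0// mulf_neq0 ?pnatr_eq0 ?y0.
have p20 : pcoord 1 h != 0.
  rewrite /h phase_vecE oppr_eq0 -[2 * _ * _]mulrA.
  by rewrite mulf_neq0 ?invr_eq0// mulf_neq0 ?pnatr_eq0 ?y0.
move: h p10 p20 => h p10 p20 dH1 dH2.
set u1 := ucoord 0 z in u10 u12 dH2 *; set u2 := ucoord 1 z in u20 u12 dH2 *.
(* Contributions of the two pairs to [dH1(v)]. Those to [dH2(v)] are [- u2 * S1] and [- u1 * S2], so
   both [S1] and [S2] vanish. *)
pose S1 := ucoord 0 v * ucoord 0 h + pcoord 0 v * pcoord 0 h.
pose S2 := ucoord 1 v * ucoord 1 h + pcoord 1 v * pcoord 1 h.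
have S12 : S1 = - S2.
  by apply/eqP; rewrite -addr_eq0; apply/eqP; rewrite -[RHS]dH1 /S1 /S2; ring.
have S20 : S2 = 0.
  apply: (mulIf u12); rewrite mul0r -oppr0 -[in RHS]dH2.
  transitivity (- (- u2 * S1 - u1 * S2)); last by rewrite /S1 /S2; ring.
  by rewrite S12; ring.
have S10 : S1 = 0 by rewrite S12 S20 oppr0.
pose t1 := ucoord 0 v / (u1 * pcoord 0 h).
pose t2 := ucoord 1 v / (u2 * pcoord 1 h).
have pv0 : pcoord 0 v = - (ucoord 0 v * ucoord 0 h) / pcoord 0 h.
  apply: (mulIf p10); rewrite divfK//; apply/eqP.
  by rewrite -addr_eq0 addrC -/S1 S10.
have pv1 : pcoord 1 v = - (ucoord 1 v * ucoord 1 h) / pcoord 1 h.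
  apply: (mulIf p20); rewrite divfK//; apply/eqP.
  by rewrite -addr_eq0 addrC -/S2 S20.
(* On pair [k] the vector [v] is [t_k] times the Hamiltonian vector of [H1], and that of [H2] is the
   latter scaled by [- u2], respectively [- u1]. The witnesses solve [c1 - u2 c2 = t1],
   [c1 - u1 c2 = t2]. *)
exists (t1 + u2 * ((t1 - t2) / (u1 - u2))), ((t1 - t2) / (u1 - u2)).
rewrite /t1 /t2.
apply: phaseP; rewrite !phase_coordE ?pv0 ?pv1; field;
  by rewrite ?u10 ?u20 ?u12 ?p10 ?p20.
Qed.

Lemma ham_comb_dot z g h1 h2 (c1 c2 : R) :
  ((c1 *: ham_vec z h1 + c2 *: ham_vec z h2) *m g^T) 0 0
    = c1 * poissonW z g h1 + c2 * poissonW z g h2.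
Proof. by rewrite mulmxDl -!scalemxAl -!ham_vec_dot !mxE. Qed.

End Interpolation.

(** * Invariance of the Hamiltonians, the quadrature and the bracket *)

Theorem proposition3 (R : realType) (a1 a2 a3 : R)
  (ha12 : a1 != a2) (ha13 : a1 != a3) (ha23 : a2 != a3)
  (U : set (phase R)) (ut : 'I_2 -> phase R -> R)
  (hU : open U)
  (hu12 : forall z, U z -> ucoord 0 z != ucoord 1 z)
  (hu0 : forall z k, U z -> ucoord k z != 0)
  (hphip : forall z k, U z -> phi a1 a2 a3 (ucoord k z) * pcoord k z != 0)
  (hA2 : forall z, U z -> A2 a1 a2 a3 z != 0)
  (hroot : forall z k, U z -> root (Utilde a1 a2 a3 z) (ut k z))
  (hsmooth : forall k, smooth_on U (ut k))
  (hut12 : forall z, U z -> ut 0 z != ut 1 z)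
  (hut0 : forall z k, U z -> ut k z != 0)
  (hphipt : forall z k, U z ->
     phi a1 a2 a3 (ut k z) * ptilde a1 a2 a3 z (ut k z) != 0) :
  let T := tilde_map a1 a2 a3 ut in
  (* (i) *)
  [/\ forall z, U z ->
        H1 a1 a2 a3 (T z) = H1 a1 a2 a3 z /\
        H2 a1 a2 a3 (T z) = H2 a1 a2 a3 z,
  (* (ii) *)
      forall (J : set R) (gamma : R -> phase R) (tau : R -> R),
        open J -> is_interval J ->
        (forall t, J t -> U (gamma t)) ->
        (forall t, J t -> derivable gamma t 1) ->
        (forall t, J t -> derivable tau t 1) ->
        (forall s t, J s -> J t ->
           H1 a1 a2 a3 (gamma s) = H1 a1 a2 a3 (gamma t) /\
           H2 a1 a2 a3 (gamma s) = H2 a1 a2 a3 (gamma t)) ->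
        Abel_quadrature a1 a2 a3 J gamma tau ->
        Abel_quadrature a1 a2 a3 J (T \o gamma) tau
  (* (iii) *)
    & forall z (i j : 'I_2), U z ->
        [/\ bracketW (ucoord i \o T) (pcoord j \o T) z
              = ucoord i (T z) * (i == j)%:R,
            bracketW (ucoord i \o T) (ucoord j \o T) z = 0
          & bracketW (pcoord i \o T) (pcoord j \o T) z = 0]].

Proof.
move=> T.
have nearU z : U z -> \forall w \near z, U w.
  by move=> Uz; move: hU; rewrite openE => /(_ z Uz).
have gen z : U z -> generic_point z.
  by move=> Uz; split; [exact: hu12|exact: hu0..].
have b20 z : U z -> B2 a1 a2 a3 z != 0 by move=> Uz; rewrite -A2_B2; auto.
have rootE k z : U z -> B2 a1 a2 a3 z * ut k z ^+ 2 + B1 a1 a2 a3 z * ut k z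
    + B0 a1 a2 a3 z = 0.
  move=> Uz; move: (hroot z k Uz) => /rootP; rewrite /Utilde !hornerE.
  by rewrite A2_B2 ?A1_B1 ?A0_B0//; exact: gen.
have phit0 k z : U z -> phi a1 a2 a3 (ut k z) != 0.
  by move=> Uz; move: (hphipt z k Uz); rewrite mulf_eq0 negb_or => /andP[].
have rel k z : U z ->
    phi a1 a2 a3 (ut k z) * ptilde a1 a2 a3 z (ut k z) ^+ 2
    = H1 a1 a2 a3 z * ut k z + H2 a1 a2 a3 z.
  move=> Uz; rewrite ptilde_spectral//; [exact: gen|exact: phit0|].
  exact: rootE.
have Tu k z : ucoord k (T z) = ut k z by rewrite ucoord_row mxE.
have Tp k z : pcoord k (T z) = ptilde a1 a2 a3 z (ut k z).
  by rewrite pcoord_row mxE.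
have TuE k : ucoord k \o T = ut k by apply/funext => z; exact: Tu.
have TpE k : pcoord k \o T = fun z => ptilde a1 a2 a3 z (ut k z).
  by apply/funext => z; exact: Tp.
(* The labelled roots are not given by a formula: their gradients come from differentiability and
   are controlled through [gutE]. *)
pose g k z : phase R := \row_i partial i (ut k) z.
have gut k z : U z -> has_grad (ut k) z (g k z).
  by move=> Uz; apply: differentiable_has_grad; exact: (hsmooth k [::] z Uz).
have gutE k z : U z ->
    (2 * B2 a1 a2 a3 z * ut k z + B1 a1 a2 a3 z) *: g k z
    = - gradU a1 a2 a3 z (ut k z).
  move=> Uz; apply: root_grad; [exact: gen| |exact: gut].
  by apply: filterS (nearU z Uz) => w; exact: rootE.
have ut10 z : U z -> ut 1 z != ut 0 z by move=> Uz; rewrite eq_sym hut12.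
have gTp k z : U z -> exists2 gp, has_grad (pcoord k \o T) z gp &
    exists c, gp = c *: g k z + (- (ut k z / phi a1 a2 a3 (ut k z))) *:
      (ut k z *: gradV1 a1 a2 a3 z + gradV0 a1 a2 a3 z).
  move=> Uz.
  have [c cP] := has_grad_ptilde (gen z Uz) (phit0 k z Uz) (gut k z Uz).
  by rewrite TpE; eexists; [exact: cP|exists c].
have gTpos k z : U z -> has_grad (ucoord k \o T) z (g k z).
  by move=> Uz; rewrite TuE; exact: gut.
(* All brackets of the new coordinates at once, for arbitrary [c0], [c1]; both (ii) and (iii) draw
   on this. *)
have bracket z (gp0 gp1 : phase R) c0 c1 : U z ->
    let gp k c := c *: g k z + (- (ut k z / phi a1 a2 a3 (ut k z))) *:
      (ut k z *: gradV1 a1 a2 a3 z + gradV0 a1 a2 a3 z) in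
    gp0 = gp 0 c0 -> gp1 = gp 1 c1 ->
  [/\ poissonW z (g 0 z) (g 1 z) = 0 /\ poissonW z gp0 gp1 = 0,
      poissonW z (g 0 z) gp0 = ut 0 z, poissonW z (g 0 z) gp1 = 0,
      poissonW z (g 1 z) gp0 = 0 & poissonW z (g 1 z) gp1 = ut 1 z].
  move=> Uz gp -> ->; rewrite /gp {gp}.
  have gz := gen z Uz; have bz := b20 z Uz.
  have r0 := rootE 0 z Uz; have r1 := rootE 1 z Uz.
  have u01 := hut12 z Uz; have u10 := ut10 z Uz.
  have g0 := gutE 0 z Uz; have g1 := gutE 1 z Uz.
  have L00 := poissonW_root_interp gz u01 bz r0 r1 g0.
  have L01 := poissonW_root_interp_other gz u01 bz r0 r1 g0.
  have L11 := poissonW_root_interp gz u10 bz r1 r0 g1.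
  have L10 := poissonW_root_interp_other gz u10 bz r1 r0 g1.
  have G01 := poissonW_roots gz u01 bz r0 r1 g0 g1.
  have G10 : poissonW z (g 1 z) (g 0 z) = 0 by rewrite poissonWC G01 oppr0.
  have LL : poissonW z (ut 0 z *: gradV1 a1 a2 a3 z + gradV0 a1 a2 a3 z)
      (ut 1 z *: gradV1 a1 a2 a3 z + gradV0 a1 a2 a3 z) = 0.
    by rewrite !poissonWE !(poissonW_commuting a1 a2 a3 gz); ring.
  have f0 := phit0 0 z Uz; have f1 := phit0 1 z Uz.
  move: (ut 0 z *: _ + _) (ut 1 z *: _ + _) L00 L01 L11 L10 LL.
  move=> L0 L1 L00 L01 L11 L10 LL.
  rewrite !poissonWE (poissonWC z L0 (g 1 z)) G01 G10 L00 L01 L11 L10 LL.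
  split; [split| | | |];
    by rewrite ?mulr0 ?oppr0 ?mulr0 ?addr0 ?add0r //; field.
split.
- move=> z Uz; apply: spectral_H; first by rewrite !Tu hut12.
  by move=> k; rewrite Tu Tp rel.
- move=> J gamma tau Jo _ JU gd _ Hc Au t Jt.
  have Uz := JU t Jt; have gz := gen _ Uz; set z := gamma t in Uz gz *.
  have dHc (H : phase R -> R) gH : has_grad H z gH ->
      (forall s, J s -> H (gamma s) = H z) -> ('D_1 gamma t *m gH^T) 0 0 = 0.
    move=> Hg Hs; rewrite -(has_grad_curve Hg (gd t Jt)).
    rewrite (near_eq_derive (g := cst (H z))) ?derive_cst//.
    by move: Jo; rewrite openE => /(_ t Jt); apply: filterS => s /Hs.
  have [|||c1 [c2 vE]] := @ham_span R a1 a2 a3 z ('D_1 gamma t) gz.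
  - by move=> k; exact: hphip.
  - by apply: dHc; [exact: has_gradH1|move=> s Js; have [] := Hc s t Js Jt].
  - by apply: dHc; [exact: has_gradH2|move=> s Js; have [] := Hc s t Js Jt].
  have sum2 (f : 'I_2 -> R) : \sum_(k < 2) f k = f 0 + f 1.
    by rewrite !big_ord_recl big_ord0 addr0; congr (_ + f _); exact: val_inj.
  set G1 := gradH1 a1 a2 a3 z in vE; set G2 := gradH2 a1 a2 a3 z in vE.
  have dE F gF : has_grad F z gF -> derive1 (F \o gamma) t =
      c1 * poissonW z gF G1 + c2 * poissonW z gF G2.
    move=> Fg; rewrite derive1E (has_grad_curve Fg (gd t Jt)).
    by rewrite vE ham_comb_dot.
  (* A quadrature taking the values 2 and 0 on the Hamiltonian vectors of [H1] and [H2] equals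
     [2 * c1] on the velocity. *)
  have abelE (F0 F1 : phase R -> R) g0 g1 y0 y1 :
      has_grad F0 z g0 -> has_grad F1 z g1 ->
      poissonW z g0 G1 / y0 + poissonW z g1 G1 / y1 = 2 /\
      poissonW z g0 G2 / y0 + poissonW z g1 G2 / y1 = 0 ->
      derive1 (F0 \o gamma) t / y0 + derive1 (F1 \o gamma) t / y1 = 2 * c1.
    move=> Fg0 Fg1 [E1 E2]; rewrite (dE _ _ Fg0) (dE _ _ Fg1).
    by rewrite -[RHS]addr0 -(mulr0 c2) -E2 -E1; ring.
  have relu k : \forall w \near z, phi a1 a2 a3 (ucoord k w) * pcoord k w ^+ 2
      = H1 a1 a2 a3 w * ucoord k w + H2 a1 a2 a3 w.
    by apply: filterS (nearU z Uz) => w Uw; apply: H_spectral; exact: gen.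
  have relT k : \forall w \near z,
      phi a1 a2 a3 ((ucoord k \o T) w) * (pcoord k \o T) w ^+ 2
      = H1 a1 a2 a3 w * (ucoord k \o T) w + H2 a1 a2 a3 w.
    by apply: filterS (nearU z Uz) => w Uw; rewrite /comp Tu Tp rel.
  (* The hypothesis trades [2 dtau] for the old quadrature; old and new are then both shown equal to
     [2 * c1]. *)
  move: (Au t Jt); rewrite !sum2 -/z => <-.
  have gu0 := has_grad_ucoord0 z; have gu1 := has_grad_ucoord1 z.
  have [s0 r0] := spectral_grad gz (relu 0) gu0 (has_grad_pcoord0 z).
  have [s1 r1] := spectral_grad gz (relu 1) gu1 (has_grad_pcoord1 z).
  have [gp0 p0 [d0 gp0E]] := gTp 0 z Uz; have [gp1 p1 [d1 gp1E]] := gTp 1 z Uz.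
  have [[uu pp] b00 b01 b10 b11] := bracket z gp0 gp1 d0 d1 Uz gp0E gp1E.
  have [s0' r0'] := spectral_grad gz (relT 0) (gTpos 0 z Uz) p0.
  have [s1' r1'] := spectral_grad gz (relT 1) (gTpos 1 z Uz) p1.
  have compT k : ((ucoord k \o T) z = ut k z) *
      ((pcoord k \o T) z = ptilde a1 a2 a3 z (ut k z)).
    by split; [exact: Tu|exact: Tp].
  rewrite !compT in r0' r1'.
  transitivity (2 * c1).
    rewrite [(T \o gamma) t]/(T z) !Tu !Tp.
    apply: (abelE _ _ _ _ _ _ (gTpos 0 z Uz) (gTpos 1 z Uz)).
    apply: (poissonW_abel _ _ _ uu b00 b01 b10 b11 r0' r1').
    - exact: hut12.
    - exact: hphipt.
    - exact: hphipt.
  apply/esym/(abelE _ _ _ _ _ _ gu0 gu1).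
  apply: (poissonW_abel _ _ _ _ _ _ _ _ r0 r1);
    rewrite ?hu12 ?hphip // /poissonW !phase_vecE; ring.
- move=> z i j Uz; have [gp0 p0 [c0 gp0E]] := gTp 0 z Uz.
  have [gp1 p1 [c1 gp1E]] := gTp 1 z Uz.
  have [[uu pp] b00 b01 b10 b11] := bracket z gp0 gp1 c0 c1 Uz gp0E gp1E.
  have u0 := gTpos 0 z Uz; have u1 := gTpos 1 z Uz.
  rewrite Tu; move: i j; apply: ord2P; apply: ord2P; split;
    rewrite ?(bracketW_grad u0 p0) ?(bracketW_grad u0 p1) ?(bracketW_grad u1 p0)
      ?(bracketW_grad u1 p1) ?(bracketW_grad u0 u1) ?(bracketW_grad u1 u0)
      ?(bracketW_grad u0 u0) ?(bracketW_grad u1 u1) ?(bracketW_grad p0 p1)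
      ?(bracketW_grad p1 p0) ?(bracketW_grad p0 p0) ?(bracketW_grad p1 p1)
      ?poissonWxx ?b00 ?b01 ?b10 ?b11 ?mulr1 ?mulr0 //.
  + by rewrite poissonWC uu oppr0.
  + by rewrite poissonWC pp oppr0.
Qed.
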